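(* Let $R$ be a ring and $M$ a right $R$-module such that $\operatorname{End}_R(M)$ has no factor ring isomorphic to $\mathbb{F}_2$. Then $M$ is quasi-injective if and only if $M$ is automorphism-invariant.
   Context: All rings are associative with identity; modules are unital right modules. $\mathbb{F}_2$ is the field with two elements. A ring $T$ ''has a factor isomorphic to $\mathbb{F}_2$'' if there is a two-sided ideal $I$ of $T$ with $T/I\cong \mathbb{F}_2$, equivalently if there exists a unital ring homomorphism $T\to\mathbb{F}_2$. $E(M)$ denotes the injective hull of $M$. A module $M$ is quasi-injective if every homomorphism from a submodule $L$ of $M$ to $M$ extends to an endomorphism of $M$ (equivalently, $\varphi(M)\subseteq M$ for every endomorphism $\varphi$ of $E(M)$). A module $M$ is automorphism-invariant if $\sigma(M)\subseteq M$ for every automorphism $\sigma$ of $E(M)$. *)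

(* Defs.v *)
(* Right R-modules are modelled as left modules over the
   converse ring R^c: the scalar action  (r : R^c) *: m  stands for  m·r. *)
From HB Require Import structures.
From mathcomp Require Import all_boot all_order all_algebra.
Set Implicit Arguments. Unset Strict Implicit. Unset Printing Implicit Defensive.
Import GRing.Theory.
Local Open Scope ring_scope.

Section ModDefs.
Variable R : pzRingType.

Definition rlin (A B : lmodType R^c) (f : A -> B) : Prop :=
  forall (a : R^c) (u v : A), f (a *: u + v) = a *: f u + f v.

Definition submodule (A : lmodType R^c) (S : A -> Prop) : Prop :=
  S 0 /\ forall (a : R^c) (u v : A), S u -> S v -> S (a *: u + v).

Definition quasi_injective (M : lmodType R^c) : Prop :=
  forall (L : M -> Prop) (f : M -> M),
    submodule L ->
    (forall (a : R^c) (u v : M), L u -> L v -> f (a *: u + v) = a *: f u + f v) ->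
    exists g : M -> M, rlin g /\ forall x, L x -> g x = f x.

Definition injective_module (E : lmodType R^c) : Prop :=
  forall (A B : lmodType R^c) (i : A -> B) (f : A -> E),
    rlin i -> injective i -> rlin f ->
    exists g : B -> E, rlin g /\ forall x, g (i x) = f x.

Definition essential_mono (M E : lmodType R^c) (j : M -> E) : Prop :=
  rlin j /\ injective j /\
  forall S : E -> Prop, submodule S -> (exists x, S x /\ x <> 0) ->
    exists m, S (j m) /\ j m <> 0.

Definition injective_hull (M E : lmodType R^c) (j : M -> E) : Prop :=
  injective_module E /\ essential_mono j.

(* M (embedded in its injective hull E via j) is invariant under every
   automorphism of E. *)
Definition aut_invariant (M E : lmodType R^c) (j : M -> E) : Prop :=
  forall sigma : E -> E, rlin sigma -> bijective sigma ->
    forall m : M, exists m' : M, sigma (j m) = j m'.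

(* End_R(M) has a factor ring isomorphic to F_2: a unital ring homomorphism
   End_R(M) -> F_2 (End_R(M) = R-linear maps M -> M, product = composition). *)
Definition End_has_F2_factor (M : lmodType R^c) : Prop :=
  exists phi : (M -> M) -> 'F_2,
    phi id = 1 /\
    forall f g : M -> M, rlin f -> rlin g ->
      phi (fun x => f x + g x) = phi f + phi g /\
      phi (f \o g) = phi f * phi g.

End ModDefs.

(* Main.v *)
(* Let E be injective and Q the quotient of End(E) by the endomorphisms with
   essential kernel, a von Neumann regular ring along which units lift. If M is
   automorphism-invariant, the endomorphisms of E preserving M form a subring
   whose image T in Q contains all units, hence all elements of square zero. By
   Zorn, take a maximal isomorphism U -> V between submodules with U and V
   independent; it yields a, b in Q with a^2 = b^2 = 0, aba = a, bab = b. The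
   ideal generated by ab + ba lies in T, and by maximality the corner at
   c = 1 - (ab + ba) is reduced, hence strongly regular. There, the support of
   x^2 - x is a central idempotent on which x and x - 1 are both units, so that
   every unit of that block is the difference of two units. Therefore x^2 - x
   always lies in the largest ideal K of Q contained in T, that is, Q/K is
   Boolean. If T were not Q, a maximal ideal over K would give a morphism
   Q -> F_2, and composing it with End(M) -> Q (extend endomorphisms of M to E)
   would contradict the hypothesis. *)
Require Import Defs.
From HB Require Import structures.
From mathcomp Require Import all_boot all_order all_algebra.
From mathcomp Require Import boolp classical_sets.
Set Implicit Arguments. Unset Strict Implicit. Unset Printing Implicit Defensive.
Import GRing.Theory.
Local Open Scope classical_set_scope.
Local Open Scope ring_scope.

(** * Zorn's lemma above a given set, and Peirce blocks of an idempotent *)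

Lemma Zorn_above (T : Type) (P : set T -> Prop) (A0 : set T) :
  P A0 ->
  (forall F : set (set T), F A0 -> (forall X, F X -> P X /\ A0 `<=` X) ->
     total_on F subset -> P (\bigcup_(X in F) X)) ->
  exists A, [/\ A0 `<=` A, P A & forall B, A `<=` B -> P B -> B `<=` A].
Proof.
move=> PA0 chain.
have [F FP totF|A [PA Amax]] := @Zorn_bigcup T (fun X => P (A0 `|` X)).
  (* Adjoining [A0] makes the chain nonempty, so [chain] applies even when [F] is empty. *)
  pose F' := [set A0] `|` [set A0 `|` X | X in F].
  have -> : A0 `|` \bigcup_(X in F) X = \bigcup_(X in F') X.
    apply/seteqP; split=> x.
      case=> [A0x|[X FX Xx]]; first by exists A0 => //; left.
      by exists (A0 `|` X); [right; exists X|right].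
    case=> _ [->|[X FX <-]]; first by left.
    by case=> [|Xx]; [left|right; exists X].
  apply: chain; first by left.
    move=> _ [->|[X FX <-]]; first by split.
    by split; [exact: FP|exact: subsetUl].
  move=> _ _ [->|[X FX <-]] [->|[Y FY <-]]; first by left.
  - by left; exact: subsetUl.
  - by right; exact: subsetUl.
  - by have [XY|YX] := totF _ _ FX FY; [left|right]; exact: setUS.
exists (A0 `|` A); split=> [|//|B AB PB]; first exact: subsetUl.
apply: contrapT => /existsNP[x /not_implyP[Bx nAx]].
apply: (Amax B).
  split=> [|/(_ x Bx) Ax]; last by apply: nAx; right.
  by move=> y Ay; apply: AB; right.
by rewrite (_ : A0 `|` B = B) //; apply/setUidPr => y A0y; apply: AB; left.
Qed.

(** These are the Peirce blocks [e x (1 - e)] and [(1 - e) x e], whose squares contain a factor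
    [(1 - e) e] or [e (1 - e)]. Written without [1], they visibly stay in any corner containing [e]
    and [x]. *)
Lemma idem_offdiag_sqr0 (Q : pzRingType) (e x : Q) : e * e = e ->
  (e * x - e * x * e) * (e * x - e * x * e) = 0 /\
  (x * e - e * x * e) * (x * e - e * x * e) = 0.
Proof.
move=> ee; split.
  have -> : (e * x - e * x * e) * (e * x - e * x * e)
    = (e * x - e * x * e) * e * (x - x * e).
    by rewrite -!mulrA mulrBr !mulrA.
  by rewrite mulrBl -!mulrA ee subrr mul0r.
have -> : (x * e - e * x * e) * (x * e - e * x * e)
  = (x - e * x) * (e * (x * e - e * x * e)).
  by rewrite mulrA mulrBl.
by rewrite mulrBr !mulrA ee subrr mulr0.
Qed.

(** * Reduced corners of a von Neumann regular ring *)

Section StronglyRegular.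
Variables (Q : pzRingType) (c : Q).

(** For idempotent [c] this is the Peirce corner [c Q c], a ring with identity [c]; as a subset it
    keeps all computations in [Q]. *)
Definition corner : set Q := [set x | c * x = x /\ x * c = x].

Hypothesis regular : forall x : Q, exists z, x * z * x = x.
Hypothesis c_idem : c * c = c.
Hypothesis reduced : forall x, corner x -> x * x = 0 -> x = 0.

Lemma cornerM x y : corner x -> corner y -> corner (x * y).
Proof. by move=> [cx _] [_ yc]; split; rewrite ?mulrA ?cx // -mulrA yc. Qed.

Lemma cornerB x y : corner x -> corner y -> corner (x - y).
Proof. by move=> [cx xc] [cy yc]; split; rewrite (mulrBr, mulrBl)
  ?cx ?cy ?xc ?yc. Qed.

Lemma corner_sandwich x : corner (c * x * c).
Proof. by split; rewrite ?mulrA ?c_idem // -mulrA c_idem. Qed.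

(** The two off-diagonal blocks of [x] square to zero, hence vanish in a reduced corner. *)
Lemma corner_idem_central e x :
  corner e -> e * e = e -> corner x -> e * x = x * e.
Proof.
move=> Ce ee Cx.
have Cex := cornerM Ce Cx; have Cxe := cornerM Cx Ce.
have [sq1 sq2] := idem_offdiag_sqr0 x ee.
have /eqP : e * x - e * x * e = 0.
  by apply: reduced => //; apply: cornerB => //; exact: cornerM.
have /eqP : x * e - e * x * e = 0.
  by apply: reduced => //; apply: cornerB => //; exact: cornerM.
by rewrite !subr_eq0 => /eqP -> /eqP.
Qed.

(** An inverse in the block at [e]; as [e] is central in a reduced corner, [z * e = z] places [z] in
    that block. *)
Definition corner_inverse (e x z : Q) : Prop :=
  [/\ corner z, x * z = e, z * x = e & z * e = z].

(** A quasi-inverse [z] of [x], compressed to the corner, makes [x * z] and [z * x] central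
    idempotents. They coincide; this common support is [e], and [z * x * z] is the inverse there. *)
Lemma strongly_regular x : corner x ->
  exists e z, [/\ corner e, e * e = e, x * e = x & corner_inverse e x z].
Proof.
move=> Cx; have [z Cz xzx] : exists2 z, corner z & x * z * x = x.
  have [z xzx] := regular x; exists (c * z * c); first exact: corner_sandwich.
  by rewrite !mulrA Cx.2 -!mulrA Cx.1 mulrA.
have xzE : x * z = z * x.
  have ii : x * z * (x * z) = x * z by rewrite mulrA xzx.
  have jj : z * x * (z * x) = z * x by rewrite -mulrA (mulrA x) xzx.
  have Ci := cornerM Cx Cz; have Cj := cornerM Cz Cx.
  (* Centrality moves [z * x] past [x] and [x * z] past [z], so both idempotents equal this
     product. *)
  transitivity (z * x * (x * z)).
    by rewrite mulrA (corner_idem_central Cj jj Cx) mulrA xzx.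
  rewrite (corner_idem_central Cj jj Ci).
  by rewrite mulrA (corner_idem_central Ci ii Cz) -mulrA xzx.
have xzxz : x * (z * x * z) = x * z by rewrite !mulrA xzx.
have zxzx : z * x * z * x = x * z by rewrite -mulrA -mulrA (mulrA x) xzx xzE.
exists (x * z), (z * x * z); split.
- exact: cornerM.
- by rewrite mulrA xzx.
- by rewrite xzE mulrA xzx.
- split=> //; first by apply: cornerM => //; exact: cornerM.
  by rewrite !mulrA zxzx xzE.
Qed.

End StronglyRegular.

(** * Subrings containing all units *)

Section UnitGenerated.
Variables (Q : pzRingType) (T : Q -> Prop).
Hypothesis TB : forall x y, T x -> T y -> T (x - y).
Hypothesis TM : forall x y, T x -> T y -> T (x * y).
Hypothesis Tunit : forall x y, x * y = 1 -> y * x = 1 -> T x.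

Lemma unitgen1 : T 1. Proof. by apply: (@Tunit 1 1); rewrite mulr1. Qed.

Lemma unitgen0 : T 0. Proof. by rewrite -(subrr 1); apply: TB; exact: unitgen1. Qed.

Lemma unitgenD x y : T x -> T y -> T (x + y).
Proof.
by move=> Tx Ty; rewrite -[y]opprK -[- y]sub0r; do !apply: TB => //; exact: unitgen0.
Qed.

(** [1 + x] is a unit with inverse [1 - x]. *)
Lemma unitgen_sqr0 x : x * x = 0 -> T x.
Proof.
move=> xx; suff T1x : T (1 + x).
  by rewrite -[x](addKr 1) addrC; apply: TB => //; exact: unitgen1.
apply: (@Tunit _ (1 - x)).
  by rewrite mulrDl mul1r mulrBr mulr1 xx subr0 subrK.
by rewrite mulrBl mul1r mulrDr mulr1 xx addr0 addrK.
Qed.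

(* For the idempotent [e = b a], the blocks [e x (1 - e)] and [(1 - e) x e]
   square to zero, and [e x e = (b a x b) a] is a product of two elements of
   square zero. *)
Lemma unitgen_swap_ideal a b : a * a = 0 -> b * b = 0 -> b * a * b = b ->
  forall x, T (b * a * x) /\ T (x * (b * a)).
Proof.
move=> aa bb bab x.
have Ta := unitgen_sqr0 aa.
have Tbaxb : T (b * a * x * b).
  by apply: unitgen_sqr0; rewrite -!mulrA (mulrA b b) bb !(mul0r, mulr0).
have ee : b * a * (b * a) = b * a by rewrite mulrA bab.
have := mulrA (b * a * x) b a.
move: (b * a) ee Tbaxb => e ee Texb exeE.
have Texe : T (e * x * e) by rewrite exeE; exact: TM.
have [sq1 sq2] := idem_offdiag_sqr0 x ee.
by split; [rewrite -[e * x](subrK (e * x * e))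
  |rewrite -[x * e](subrK (e * x * e))];
  apply: unitgenD => //; exact: unitgen_sqr0.
Qed.

(* The largest two-sided ideal contained in the subring [T]. *)
Definition unitgen_ideal : set Q := [set x | forall s t, T (s * x * t)].

Lemma unitgen_idealT x : unitgen_ideal x -> T x.
Proof. by move=> /(_ 1 1); rewrite mul1r mulr1. Qed.

Lemma unitgen_ideal0 : unitgen_ideal 0.
Proof. by move=> s t; rewrite mulr0 mul0r; exact: unitgen0. Qed.

Lemma unitgen_idealD x y : unitgen_ideal x -> unitgen_ideal y -> unitgen_ideal (x + y).
Proof. by move=> Kx Ky s t; rewrite mulrDr mulrDl; apply: unitgenD. Qed.

Lemma unitgen_idealB x y : unitgen_ideal x -> unitgen_ideal y -> unitgen_ideal (x - y).
Proof. by move=> Kx Ky s t; rewrite mulrBr mulrBl; apply: TB. Qed.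

Lemma unitgen_idealMl u x : unitgen_ideal x -> unitgen_ideal (u * x).
Proof. by move=> Kx s t; rewrite mulrA. Qed.

Lemma unitgen_idealMr u x : unitgen_ideal x -> unitgen_ideal (x * u).
Proof. by move=> Kx s t; rewrite mulrA -(mulrA _ u). Qed.

Hypothesis regular : forall x : Q, exists z, x * z * x = x.

Section Corner.
Variable c : Q.
Hypothesis c_idem : c * c = c.
Hypothesis reduced : forall x, corner c x -> x * x = 0 -> x = 0.

Let central := corner_idem_central reduced.

(** Reduced corners are Dedekind finite: [g = q * e * p] is a central idempotent, and
    [p * g * q = e] can be rearranged into [g * p * q = q * p * e]. *)
Lemma corner_inverse_comm e p q :
    corner c e -> e * e = e -> corner c p -> corner c q -> p * q = e ->
  q * p * e = e.
Proof.
move=> Ce ee Cp Cq pq; pose g := q * e * p.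
have Cg : corner c g by do !apply: cornerM.
have gg : g * g = g.
  by rewrite /g -!mulrA (mulrA p) pq (mulrA e e) ee (mulrA e e) ee.
transitivity (p * g * q); last first.
  by rewrite /g !mulrA pq ee -mulrA pq ee.
rewrite -(central Cg gg Cp) -(mulrA g) pq /g -!mulrA.
by rewrite -(central Ce ee Cp) (mulrA e) ee.
Qed.

(** A unit of the block at [e] becomes a unit of [Q] after adding [1 - e]; the inverse here is
    [q * z + (1 - e)]. *)
Lemma unitgen_corner_unit e y z p q :
    corner c e -> e * e = e -> corner c y -> y * e = y ->
    corner_inverse c e y z -> corner c p -> corner c q -> p * q = e ->
    q * e = q ->
  T (y * p + (1 - e)).
Proof.
move=> Ce ee Cy ye [Cz yz zy ze] Cp Cq pq qe.
have qpe := corner_inverse_comm Ce ee Cp Cq pq.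
have eyp : e * (y * p) = y * p by rewrite mulrA (central Ce ee Cy) ye.
have ype : y * p * e = y * p.
  by rewrite -mulrA -(central Ce ee Cp) mulrA ye.
have eqz : e * (q * z) = q * z by rewrite mulrA (central Ce ee Cq) qe.
have qze : q * z * e = q * z by rewrite -mulrA ze.
have f0 : e * (1 - e) = 0 by rewrite mulrBr mulr1 ee subrr.
have f0' : (1 - e) * e = 0 by rewrite mulrBl mul1r ee subrr.
have ff : (1 - e) * (1 - e) = 1 - e by rewrite mulrBr mulr1 f0' subr0.
have ef1 : e + (1 - e) = 1 by rewrite addrC subrK.
move: (1 - e) f0 f0' ff ef1 => f ef fe ff ef1.
have inv u v : u * e = u -> e * v = v -> u * v = e -> (u + f) * (v + f) = 1.
  move=> ue ev uv; rewrite mulrDl !mulrDr uv ff -ue -(mulrA u) ef mulr0 addr0.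
  by rewrite -ev mulrA fe mul0r add0r.
apply: (@Tunit _ (q * z + f)); apply: inv => //.
  by rewrite mulrA -(mulrA y) pq ye.
by rewrite mulrA -(mulrA q) zy -mulrA (central Ce ee Cp) mulrA.
Qed.

(* If [e] is the support of [r (x^2 - x) t], then [x e] and [(1 - x) e] are
   units of the corner at [e], so every unit there is a difference of two. *)
Lemma unitgen_corner_boolean r x t : corner c r -> corner c x -> corner c t ->
  T (r * (x * x - x) * t).
Proof.
move=> Cr Cx Ct; set y := _ * t.
have Cxx : corner c (x * x - x) by apply: cornerB => //; exact: cornerM.
have Cy : corner c y by do !apply: cornerM => //.
have [e [z [Ce ee ye yinv]]] := strongly_regular regular c_idem reduced Cy.
have [Cz yz zy ze] := yinv.
(* The relation [y * z = e] says that [r] has right inverse [(x * x - x) * t * z] at [e]; commuting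
   the two factors exhibits the inverse [w] of [x * x - x]. *)
have [w [Cw we xxw]] : exists w, [/\ corner c w, w * e = w
    & (x * x - x) * w = e].
  exists (t * z * r * e); split; first by do !apply: cornerM => //.
    by rewrite -mulrA ee.
  have := @corner_inverse_comm e r ((x * x - x) * t * z) Ce ee Cr.
  rewrite !mulrA; apply; last by [].
  by do !apply: cornerM.
(* As [x * (x * w - w) = (x * x - x) * w = e], the factor [x * w - w] inverts [x] at [e]; in the
   same way [x * w] inverts [x - c] below. *)
have Tx : T (y * x + (1 - e)).
  apply: (@unitgen_corner_unit e y z x (x * w - w)) => //.
  - by apply: cornerB => //; exact: cornerM.
  - by rewrite mulrBr mulrA -mulrBl.
  - by rewrite mulrBl -mulrA we.
have Tx1 : T (y * (x - c) + (1 - e)).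
  apply: (@unitgen_corner_unit e y z (x - c) (x * w)) => //.
  - by apply: cornerB => //; split.
  - exact: cornerM.
  - by rewrite mulrBl !mulrA Cx.1 -mulrBl.
  - by rewrite -mulrA we.
have -> : y = (y * x + (1 - e)) - (y * (x - c) + (1 - e)).
  by rewrite opprD addrACA subrr addr0 -mulrBr subKr Cy.2.
exact: TB.
Qed.

End Corner.

Variables a b : Q.
Hypothesis aa : a * a = 0.
Hypothesis bb : b * b = 0.
Hypothesis aba : a * b * a = a.
Hypothesis bab : b * a * b = b.
Let n : Q := a * b + b * a.
Let c : Q := 1 - n.
Hypothesis reduced : forall x, corner c x -> x * x = 0 -> x = 0.

Let n_idem : n * n = n.
Proof.
by rewrite /n mulrDl !mulrDr !mulrA aba bab -(mulrA a b b) bb -(mulrA b a a) aa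
  !mulr0 !mul0r addr0 add0r.
Qed.

(** For [e = a * b] or [e = b * a], write [s * e * t = (s * e) * (e * t)]; both factors lie in
    [T]. *)
Let unitgen_ideal_n : unitgen_ideal n.
Proof.
have K e : e * e = e -> (forall x, T (e * x) /\ T (x * e)) -> unitgen_ideal e.
  move=> ee Te s t; rewrite -ee mulrA -mulrA.
  by apply: TM; [case: (Te s)|case: (Te t)].
apply: unitgen_idealD; apply: K.
- by rewrite mulrA aba.
- exact: unitgen_swap_ideal.
- by rewrite mulrA bab.
- exact: unitgen_swap_ideal.
Qed.

Let c_idem : c * c = c.
Proof. by rewrite /c mulrBr mulr1 mulrBl mul1r n_idem subrr subr0. Qed.

Let unitgen_ideal_compress (x : Q) : unitgen_ideal (x - c * x * c).
Proof.
have -> : x - c * x * c = n * x + c * x * n.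
  have -> : c * x * c = c * x - c * x * n by rewrite {2}/c mulrBr mulr1.
  by rewrite opprB addrCA addrC /c mulrBl mul1r subKr.
by apply: unitgen_idealD; [exact: unitgen_idealMr|exact: unitgen_idealMl].
Qed.

(** Modulo the ideal, [x] and the multipliers [s], [t] may all be compressed to the corner at [c],
    where [unitgen_corner_boolean] applies. *)
Lemma unitgen_ideal_boolean (x : Q) : unitgen_ideal (x * x - x).
Proof.
have Kmod u v : unitgen_ideal (u - v) -> unitgen_ideal v -> unitgen_ideal u.
  by move=> Kuv Kv; rewrite -[u](subrK v); exact: unitgen_idealD.
have Csand := corner_sandwich c_idem.
pose x' := c * x * c; apply: (Kmod _ (x' * x' - x')).
  have -> : x * x - x - (x' * x' - x')
      = (x - x') * x + x' * (x - x') - (x - x').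
    by rewrite mulrBl mulrBr addrA subrK opprD addrACA -opprD.
  apply: unitgen_idealB; last exact: unitgen_ideal_compress.
  by apply: unitgen_idealD; [apply: unitgen_idealMr|apply: unitgen_idealMl];
    exact: unitgen_ideal_compress.
have Cx' : corner c x' by exact: Csand.
have splitM (s s' t t' y : Q) :
    s * y * t = (s - s') * y * t + s' * y * (t - t') + s' * y * t'.
  by rewrite -addrA -mulrDr subrK -!mulrDl subrK.
move=> s t; rewrite (splitM s (c * s * c) t (c * t * c)).
apply: unitgenD; last by apply: (unitgen_corner_boolean c_idem reduced); exact: Csand.
by apply: unitgenD; apply: unitgen_idealT;
  [do 2!apply: unitgen_idealMr|apply: unitgen_idealMl];
  exact: unitgen_ideal_compress.
Qed.

End UnitGenerated.

(** * Boolean quotients *)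

Section BooleanQuotient.
Variable Q : pzRingType.

Definition two_sided_ideal (I : set Q) : Prop :=
  [/\ I 0, forall x y, I x -> I y -> I (x - y), forall u x, I x -> I (u * x)
    & forall u x, I x -> I (x * u)].

Lemma ideal_bigcup (F : set (set Q)) (I0 : set Q) : F I0 ->
    (forall I, F I -> two_sided_ideal I) -> total_on F subset ->
  two_sided_ideal (\bigcup_(I in F) I).
Proof.
move=> FI0 idF totF; split.
- by exists I0 => //; case: (idF _ FI0).
- move=> x y [I FI Ix] [J FJ Jy].
  have [IJ|JI] := totF _ _ FI FJ; [exists J|exists I] => //.
    by case: (idF _ FJ) => _ JB _ _; apply: JB => //; exact: IJ.
  by case: (idF _ FI) => _ IB _ _; apply: IB => //; exact: JI.
- by move=> u x [I FI Ix]; exists I => //; case: (idF _ FI) => _ _ + _; apply.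
- by move=> u x [I FI Ix]; exists I => //; case: (idF _ FI) => _ _ _; apply.
Qed.

Variable K : set Q.
Hypothesis idealK : two_sided_ideal K.
Hypothesis K1 : ~ K 1.
Hypothesis booleanK : forall x, K (x * x - x).

Lemma boolean_two : K (1 + 1).
Proof. by have := booleanK (1 + 1); rewrite mulrDl mul1r addrK. Qed.

(** Expanding [(x + y)^2 - (x + y)] puts [x * y + y * x] in [K]; the sign is changed using [1 + 1]
    in [K]. *)
Lemma boolean_comm x y : K (x * y - y * x).
Proof.
have [K0 KB KMl KMr] := idealK.
have KN z : K z -> K (- z) by move=> Kz; rewrite -sub0r; exact: KB.
have KD u v : K u -> K v -> K (u + v).
  by move=> Ku Kv; rewrite -[v]opprK; apply: KB => //; exact: KN.
have Kxy : K (x * y + y * x).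
  have sqE : (x + y) * (x + y) - (x + y)
      = (x * x - x) + (y * y - y) + (x * y + y * x).
    rewrite mulrDl !mulrDr [y * x + _]addrC addrACA addrAC opprD.
    by rewrite [x * x + _ + y * y]addrAC [_ + (- x - y)]addrAC
      [x * x + y * y + _]addrACA.
  rewrite -(addKr (x * x - x + (y * y - y)) (x * y + y * x)) -sqE addrC.
  by apply: KB => //; exact: KD.
have -> : x * y - y * x = (x * y + y * x) - (1 + 1) * (y * x).
  by rewrite mulrDl mul1r opprD addrA addrK.
by apply: KB => //; apply: KMr; exact: boolean_two.
Qed.

(** A maximal ideal [P] over [K] has a simple Boolean quotient, hence one with two elements; [phi]
    is the indicator of the complement of [P]. *)
Lemma boolean_F2_morphism : exists phi : Q -> 'F_2,
  [/\ phi 1 = 1, forall x y, phi (x + y) = phi x + phi y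
    & forall x y, phi (x * y) = phi x * phi y].
Proof.
have [F FK Fid totF|P [KP [idP P1] Pmax]] :=
    @Zorn_above Q (fun I => two_sided_ideal I /\ ~ I 1) K (conj idealK K1).
  split; last by case=> I /Fid[[_ +] _].
  by apply: (ideal_bigcup FK) => // I /Fid[[]].
have [P0 PB PMl PMr] := idP.
have PD u v : P u -> P v -> P (u + v).
  by move=> Pu Pv; rewrite -[v]opprK -[- v]sub0r; do !apply: (PB) => //.
have PC x : ~ P x -> P (1 - x).
  (* The ideal quotient of [P] by [1 - x], two-sided because commutators lie in [K]. It contains [P]
     and [x], so maximality forces it to contain [1]. *)
  move=> nPx; pose I : set Q := [set z | P (z * (1 - x))].
  have idI : two_sided_ideal I.
    split; rewrite /I /=.
    - by rewrite mul0r.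
    - by move=> u v Pu Pv; rewrite mulrBl; exact: PB.
    - by move=> u v Pv; rewrite -mulrA; exact: PMl.
    - move=> u v Pv; have -> : v * u * (1 - x)
          = v * (1 - x) * u + v * (u * (1 - x) - (1 - x) * u).
        by rewrite [v * (u * _ - _)]mulrBr !mulrA [RHS]addrC subrK.
      by apply: PD; [exact: PMr|apply: PMl; apply: KP; exact: boolean_comm].
  have [I1|nI1] := pselect (I 1); first by rewrite -[1 - x]mul1r.
  have PI : P `<=` I by move=> z Pz; exact: PMr.
  case: nPx; apply: (Pmax I PI) => //.
  rewrite /I /= mulrBr mulr1 -opprB -sub0r; apply: PB => //.
  by apply: KP; exact: booleanK.
have Pnot x : P (1 - x) -> ~ P x.
  by move=> P1x Px; apply: P1; rewrite -(subrK x 1); exact: PD.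
pose phi x : 'F_2 := (~~ `[< P x >])%:R.
have phi0 x : P x -> phi x = 0 by move=> Px; rewrite /phi asboolT.
have phi1 x : ~ P x -> phi x = 1 by move=> nPx; rewrite /phi asboolF.
exists phi; split; first exact: phi1.
- move=> x y; have [Px|nPx] := pselect (P x); have [Py|nPy] := pselect (P y).
  + by rewrite !phi0 ?addr0 //; exact: PD.
  + rewrite (phi0 x) // (phi1 y) // add0r phi1 // => Pxy; apply: nPy.
    by rewrite -(addKr x y) addrC; exact: PB.
  + rewrite (phi1 x) // (phi0 y) // addr0 phi1 // => Pxy; apply: nPx.
    by rewrite -(addrK y x); exact: PB.
  + rewrite (phi1 x) // (phi1 y) // phi0; first exact: val_inj.
    have -> : x + y = (1 + 1) - ((1 - x) + (1 - y)).
      by rewrite addrACA -opprD subKr.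
    by apply: PB; [apply: KP; exact: boolean_two|apply: PD; exact: PC].
- move=> x y; have [Px|nPx] := pselect (P x).
    by rewrite (phi0 x) // mul0r phi0 //; exact: PMr.
  have [Py|nPy] := pselect (P y).
    by rewrite (phi0 y) // mulr0 phi0 //; exact: PMl.
  rewrite (phi1 x) // (phi1 y) // mulr1 phi1 //; apply: Pnot.
  have -> : 1 - x * y = (1 - x) + x * (1 - y).
    by rewrite mulrBr mulr1 addrA subrK.
  by apply: PD; [|apply: PMl]; exact: PC.
Qed.

End BooleanQuotient.

(** * Endomorphisms modulo essential kernels *)

Section Essential.
Variables (R : pzRingType) (E : lmodType R^c).

Lemma rlin_raddf (A B : lmodType R^c) (f : A -> B) : rlin f ->
  [/\ f 0 = 0, forall x y, f (x + y) = f x + f y,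
      forall x y, f (x - y) = f x - f y & forall r x, f (r *: x) = r *: f x].
Proof.
move=> fl; have fD x y : f (x + y) = f x + f y.
  by rewrite -[x]scale1r fl !scale1r.
have f0 : f 0 = 0 by apply: (@addrI _ (f 0)); rewrite -fD !addr0.
have fZ r x : f (r *: x) = r *: f x by rewrite -[r *: x]addr0 fl f0 addr0.
by split=> // x y; rewrite fD -scaleN1r fZ scaleN1r.
Qed.

(** For submodules this is the usual notion, tested on cyclic submodules; this form makes sense for
    every subset. *)
Definition essential (X : set E) : Prop :=
  forall x, x <> 0 -> exists r : R^c, r *: x <> 0 /\ X (r *: x).

Lemma essentialS (X Y : set E) : X `<=` Y -> essential X -> essential Y.
Proof. by move=> XY eX x /eX[r [rx Xrx]]; exists r; split=> //; exact: XY. Qed.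

Lemma submoduleZ (X : set E) r x : submodule X -> X x -> X (r *: x).
Proof. by move=> [X0 XL] Xx; rewrite -[_ *: _]addr0; exact: XL. Qed.

Lemma submoduleD (X : set E) x y : submodule X -> X x -> X y -> X (x + y).
Proof. by move=> [X0 XL] Xx Xy; rewrite -[x]scale1r; exact: XL. Qed.

Lemma submoduleN (X : set E) x : submodule X -> X x -> X (- x).
Proof. by move=> sX Xx; rewrite -scaleN1r; exact: submoduleZ. Qed.

Lemma submoduleB (X : set E) x y : submodule X -> X x -> X y -> X (x - y).
Proof. by move=> sX Xx Xy; apply: submoduleD => //; exact: submoduleN. Qed.

Lemma submodule_eq (f g : E -> E) : rlin f -> rlin g ->
  submodule [set x | f x = g x].
Proof.
move=> fl gl; have [f0 _ _ _] := rlin_raddf fl;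
have [g0 _ _ _] := rlin_raddf gl.
by split=> [|a u v /= fu fv]; rewrite /= ?f0 ?g0 // fl gl fu fv.
Qed.

Lemma essentialI (X Y : set E) :
  submodule X -> essential X -> essential Y -> essential (X `&` Y).
Proof.
move=> sX eX eY x /eX[r [/eY[s [srx Ysrx]] Xrx]].
by exists (s * r); rewrite -scalerA; split=> //; split=> //; exact: submoduleZ.
Qed.

Lemma essential_preimage (f : E -> E) (X : set E) :
  rlin f -> X 0 -> essential X -> essential (f @^-1` X).
Proof.
move=> /rlin_raddf[f0 _ _ fZ] X0 eX x x0.
have [fx0|/eX[r [rfx Xrfx]]] := pselect (f x = 0).
  by exists 1; rewrite scale1r /= fx0.
by exists r; rewrite /= fZ; split=> // rx; apply: rfx; rewrite -fZ rx f0.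
Qed.

Lemma essential_setT : essential setT.
Proof. by move=> x x0; exists 1; rewrite scale1r. Qed.

End Essential.

Section Endo.
Variables (R : pzRingType) (E : lmodType R^c).

Record endo := Endo { endo_fun :> E -> E; endoP : rlin endo_fun }.

HB.instance Definition _ := gen_eqMixin endo.
HB.instance Definition _ := gen_choiceMixin endo.

Lemma endo_ext (f g : endo) : f =1 g -> f = g.
Proof.
case: f g => f fl [g gl] /= /funext fg; case: _ / fg in gl *.
by congr Endo; exact: Prop_irrelevance.
Qed.

Definition endo0 : endo.
Proof. by exists (fun=> 0) => a u v; rewrite scaler0 addr0. Defined.

Definition endo1 : endo.
Proof. by exists id. Defined.

Definition endo_add (f g : endo) : endo.
Proof.
exists (fun x => f x + g x) => a u v.
by rewrite !endoP scalerDr addrACA.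
Defined.

Definition endo_opp (f : endo) : endo.
Proof. by exists (fun x => - f x) => a u v; rewrite endoP opprD scalerN. Defined.

Definition endo_mul (f g : endo) : endo.
Proof. by exists (f \o g) => a u v; rewrite /= !endoP. Defined.

Definition endo_equiv (f g : endo) := `[< essential [set x | f x = g x] >].

Lemma endo_equiv_refl : reflexive endo_equiv.
Proof.
by move=> f; apply/asboolP; apply: essentialS (@essential_setT _ E) => x.
Qed.

Lemma endo_equiv_sym : symmetric endo_equiv.
Proof.
by move=> f g; apply/asboolP/asboolP; apply: essentialS => x /= ->.
Qed.

Lemma endo_equiv_trans : transitive endo_equiv.
Proof.
move=> g f h /asboolP fg /asboolP gh; apply/asboolP.
apply: essentialS (essentialI _ fg gh) => [x /= [-> ->] //|].
by apply: submodule_eq; exact: endoP.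
Qed.

Canonical endo_equiv_rel :=
  EquivRel endo_equiv endo_equiv_refl endo_equiv_sym endo_equiv_trans.

(* The quotient of the endomorphism ring by the ideal of endomorphisms with
   essential kernel; for injective [E] this is the Jacobson radical. *)
Definition endoq := {eq_quot endo_equiv}%qT.

HB.instance Definition _ := Choice.on endoq.
HB.instance Definition _ := EqQuotient.on endoq.

Local Notation pi := (\pi_endoq)%qT.

Lemma endoq_eqP (f g : endo) :
  pi f = pi g <-> essential [set x | f x = g x].
Proof.
by split=> [/eqmodP/asboolP|fg] //; apply/eqmodP/asboolP.
Qed.

Definition endoq_add (p q : endoq) : endoq := pi (endo_add (repr p) (repr q)).
Definition endoq_opp (p : endoq) : endoq := pi (endo_opp (repr p)).
Definition endoq_mul (p q : endoq) : endoq := pi (endo_mul (repr p) (repr q)).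

Lemma repr_endoq (f : endo) : essential [set x | repr (pi f) x = f x].
Proof. by apply/endoq_eqP; rewrite reprK. Qed.

Lemma endoq_addE f g : endoq_add (pi f) (pi g) = pi (endo_add f g).
Proof.
apply/endoq_eqP; apply: essentialS (essentialI _ (repr_endoq f) (repr_endoq g)).
  by move=> x [/= -> ->].
by apply: submodule_eq; exact: endoP.
Qed.

Lemma endoq_oppE f : endoq_opp (pi f) = pi (endo_opp f).
Proof. by apply/endoq_eqP; apply: essentialS (repr_endoq f) => x /= ->. Qed.

(** The composites agree where [g] agrees with its representative and takes values in the set where
    [f] agrees with its own; that preimage is again essential. *)
Lemma endoq_mulE f g : endoq_mul (pi f) (pi g) = pi (endo_mul f g).
Proof.
apply/endoq_eqP.
apply: essentialS (essentialI _ (repr_endoq g)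
  (essential_preimage (endoP g) _ (repr_endoq f))) => [x [/= -> ->] //||].
  by apply: submodule_eq; exact: endoP.
by have [/= + _] := submodule_eq (endoP (repr (pi f))) (endoP f).
Qed.

Definition endoqE := (endoq_addE, endoq_oppE, endoq_mulE).

Lemma endoqP (P : endoq -> Prop) : (forall f, P (pi f)) -> forall q, P q.
Proof. by move=> Ppi q; rewrite -[q]reprK. Qed.

Lemma endoq_addA : associative endoq_add.
Proof.
by do 3!elim/endoqP => ?; rewrite !endoqE; congr (pi _); apply: endo_ext => x /=;
  rewrite addrA.
Qed.

Lemma endoq_addC : commutative endoq_add.
Proof.
by do 2!elim/endoqP => ?; rewrite !endoqE; congr (pi _); apply: endo_ext => x /=;
  rewrite addrC.
Qed.

Lemma endoq_add0 : left_id (pi endo0) endoq_add.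
Proof.
by elim/endoqP => ?; rewrite !endoqE; congr (pi _); apply: endo_ext => x /=;
  rewrite add0r.
Qed.

Lemma endoq_addN : left_inverse (pi endo0) endoq_opp endoq_add.
Proof.
by elim/endoqP => ?; rewrite !endoqE; congr (pi _); apply: endo_ext => x /=;
  rewrite addNr.
Qed.

Lemma endoq_mulA : associative endoq_mul.
Proof.
by do 3!elim/endoqP => ?; rewrite !endoqE; congr (pi _); exact: endo_ext.
Qed.

Lemma endoq_mul1l : left_id (pi endo1) endoq_mul.
Proof. by elim/endoqP => ?; rewrite !endoqE; congr (pi _); exact: endo_ext. Qed.

Lemma endoq_mul1r : right_id (pi endo1) endoq_mul.
Proof. by elim/endoqP => ?; rewrite !endoqE; congr (pi _); exact: endo_ext. Qed.

Lemma endoq_mulDl : left_distributive endoq_mul endoq_add.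
Proof.
by do 3!elim/endoqP => ?; rewrite !endoqE; congr (pi _); exact: endo_ext.
Qed.

Lemma endoq_mulDr : right_distributive endoq_mul endoq_add.
Proof.
elim/endoqP => f; do 2!elim/endoqP => ?.
rewrite !endoqE; congr (pi _); apply: endo_ext => x /=.
by have [_ -> _ _] := rlin_raddf (endoP f).
Qed.

HB.instance Definition _ := GRing.isPzRing.Build endoq endoq_addA endoq_addC
  endoq_add0 endoq_addN endoq_mulA endoq_mul1l endoq_mul1r endoq_mulDl
  endoq_mulDr.

Lemma pi_endo0 : pi endo0 = 0. Proof. by []. Qed.
Lemma pi_endo1 : pi endo1 = 1. Proof. by []. Qed.
Lemma pi_endo_add f g : pi f + pi g = pi (endo_add f g).
Proof. exact: endoq_addE. Qed.
Lemma pi_endo_opp f : - pi f = pi (endo_opp f).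
Proof. exact: endoq_oppE. Qed.
Lemma pi_endo_mul f g : pi f * pi g = pi (endo_mul f g).
Proof. exact: endoq_mulE. Qed.

End Endo.

(** * Injective modules *)

Section Submodules.
Variables (R : pzRingType) (E : lmodType R^c).

Lemma submodule_bigcup (F : set (set E)) (X0 : set E) : F X0 ->
    (forall X, F X -> submodule X) -> total_on F subset ->
  submodule (\bigcup_(X in F) X).
Proof.
move=> FX0 sF totF; split; first by exists X0 => //; case: (sF _ FX0).
move=> a x y [X FX Xx] [Y FY Yy].
have [XY|YX] := totF _ _ FX FY; [exists Y|exists X] => //.
  by case: (sF _ FY) => _; apply=> //; exact: XY.
by case: (sF _ FX) => _; apply=> //; exact: YX.
Qed.

Definition sum_set (X Y : set E) : set E :=
  [set z | exists x y, [/\ X x, Y y & z = x + y]].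

Lemma submodule_sum X Y : submodule X -> submodule Y -> submodule (sum_set X Y).
Proof.
move=> sX sY; split; first by exists 0, 0; rewrite addr0; case: sX sY => ? _ [].
move=> a _ _ [x [y [Xx Yy ->]]] [x' [y' [Xx' Yy' ->]]].
exists (a *: x + x'), (a *: y + y'); rewrite scalerDr addrACA.
by split=> //; [apply sX|apply sY].
Qed.

Lemma submodule_line (x : E) : submodule [set r *: x | r in [set: R^c]].
Proof.
split; first by exists 0; rewrite ?scale0r.
by move=> a _ _ [r _ <-] [s _ <-]; exists (a * r + s); rewrite // scalerDl scalerA.
Qed.

(** Take [C] maximal among submodules independent of [A]. For nonzero [z], either [C] plus the line
    of [z] is still independent of [A], so [z] is in [C], or that sum meets [A], and a nonzero
    multiple of [z] falls in [A + C]. *)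
Lemma essential_complement (A : set E) : submodule A -> exists C : set E,
  [/\ submodule C, forall x, A x -> C x -> x = 0 & essential (sum_set A C)].
Proof.
move=> sA; pose P (C : set E) := submodule C /\ forall x, A x -> C x -> x = 0.
have P0 : P [set 0].
  split=> [|x _ //]; split=> [//|a _ _ -> ->].
  by rewrite /= scaler0 addr0.
have [F F0 PF totF|C [_ [sC disjAC] Cmax]] := Zorn_above P0.
  split=> [|x Ax [X FX Xx]]; last by have [[_ disjX] _] := PF _ FX; exact: disjX.
  by apply: (submodule_bigcup F0) => // X /PF[[]].
exists C; split=> // z z0.
pose D := sum_set C [set r *: z | r in [set: R^c]].
have sD : submodule D by apply: submodule_sum => //; exact: submodule_line.
have [disjAD|] := pselect (forall x, A x -> D x -> x = 0).
  exists 1; rewrite scale1r; split=> //; exists 0, z; rewrite add0r.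
  split=> //; first by case: sA.
  apply: (Cmax D) => //.
    by move=> x Cx; exists x, 0; rewrite addr0; split=> //; exists 0; rewrite ?scale0r.
  by exists 0, z; rewrite add0r; split=> //; [case: sC|exists 1; rewrite ?scale1r].
move=> /existsNP[x /not_implyP[Ax /not_implyP[[y [_ [Cy [r _ <-] xE]]] x0]]].
exists r; split=> [rz|].
  by apply: x0; apply: disjAC; rewrite // xE rz addr0.
exists x, (- y); split=> //; first exact: submoduleN.
by rewrite xE addrC addKr.
Qed.

End Submodules.

Section Graph.
Variables (R : pzRingType) (E : lmodType R^c) (G : set (E * E)).
Hypothesis sG : submodule G.

Definition graph_pred : {pred E * E} := fun p => `[< G p >].

Lemma graph_pred_closed : GRing.submod_closed graph_pred.
Proof.
case: sG => G0 GL; split; first exact/asboolP.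
by move=> r x y /asboolP Gx /asboolP Gy; apply/asboolP; exact: GL.
Qed.

HB.instance Definition _ :=
  GRing.isSubmodClosed.Build R^c _ graph_pred graph_pred_closed.

Definition graph := {p : (E * E)%type | p \in graph_pred}.

HB.instance Definition _ := SubChoice.on graph.
HB.instance Definition _ := [SubChoice_isSubLmodule of graph by <:].

(** Injectivity of [E] is applied to the module [graph]: its first projection is an embedding into
    [E], and its second is the map to extend. *)
Lemma graph_extension : injective_module E ->
    (forall y, G (0, y) -> y = 0) ->
  exists g : endo E, forall x y, G (x, y) -> g x = y.
Proof.
move=> injE Gfun.
have [|||g [gl gE]] := injE graph E (fun p => (val p).1) (fun p => (val p).2).
- by move=> a u v; rewrite linearP.
- move=> p q pq; have pq1 : (val (p - q)).1 = 0.
    by rewrite raddfB -[LHS]/((val p).1 - (val q).1) pq subrr.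
  have : G (val (p - q)) by apply/asboolP; exact: (valP (p - q)).
  rewrite (surjective_pairing (val (p - q))) pq1 => /Gfun pq2.
  move: pq2; rewrite raddfB -[LHS]/((val p).2 - (val q).2) => /subr0_eq pq2.
  apply: val_inj; rewrite (surjective_pairing (val p)) pq2.
  by rewrite (_ : (val p).1 = (val q).1) // -surjective_pairing.
- by move=> a u v; rewrite linearP.
exists (Endo gl) => x y Gxy.
have Gp : (x, y) \in graph_pred by apply/asboolP.
exact: (gE (exist _ (x, y) Gp)).
Qed.

End Graph.

Section InjectiveModule.
Variables (R : pzRingType) (E : lmodType R^c).
Hypothesis injE : injective_module E.

Local Notation pi := (\pi_(endoq E))%qT.

(** Partial linear maps are given by their graphs; by linearity, single-valuedness need only be
    checked at [0]. *)
Lemma linear_extension (F : E -> E -> Prop) : F 0 0 ->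
    (forall (r : R^c) x y x' y', F x y -> F x' y' ->
       F (r *: x + x') (r *: y + y')) ->
    (forall y, F 0 y -> y = 0) ->
  exists g : endo E, forall x y, F x y -> g x = y.
Proof.
move=> F0 FL Ffun; apply: (@graph_extension _ _ [set p | F p.1 p.2]) => //.
by split=> // a [x y] [x' y'] /=; exact: FL.
Qed.

(** [f] is injective on a complement [C] of its kernel. Extending the inverse of this restriction to
    [g] gives [f g f = f] on the essential submodule [ker f + C]. *)
Lemma endoq_regular (x : endoq E) : exists z, x * z * x = x.
Proof.
elim/endoqP: x => f; have [f0 fD _ fZ] := rlin_raddf (endoP f).
have sker : submodule [set x | f x = 0].
  by split=> // a u v /= fu fv; rewrite fD fZ fu fv scaler0 addr0.
have [C [sC disjC essC]] := essential_complement sker.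
have [||x [Cx /esym fx]|g gE] :=
    @linear_extension (fun y x => C x /\ y = f x).
- by split; rewrite ?f0 //; case: sC.
- by move=> r _ y _ y' [Cy ->] [Cy' ->]; split; [apply sC|rewrite endoP].
- exact: disjC.
exists (pi g); rewrite !pi_endo_mul; apply/endoq_eqP.
apply: essentialS essC => _ [x [y [/= fx Cy ->]]].
by rewrite fD fx add0r (gE _ y).
Qed.

(** Every representative of a unit is bijective: [gf] excludes kernel vectors, and injectivity of
    [E] then gives a left inverse [p] of [f]. *)
Lemma endoq_unit_bijective (f g : endo E) :
  pi f * pi g = 1 -> pi g * pi f = 1 -> bijective f.
Proof.
rewrite !pi_endo_mul => /endoq_eqP /= fg /endoq_eqP /= gf.
have [f0 _ fB fZ] := rlin_raddf (endoP f);
have [g0 _ _ gZ] := rlin_raddf (endoP g).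
have kerf x : f x = 0 -> x = 0.
  move=> fx; apply: contrapT => /gf[r [rx]] /=; rewrite fZ fx scaler0 g0.
  by move=> /esym.
have [||x fx|p pE] := @linear_extension (fun y x => y = f x).
- by rewrite f0.
- by move=> r _ y _ y' -> ->; rewrite endoP.
- exact: kerf.
have [p0 _ pB pZ] := rlin_raddf (endoP p).
have pf x : p (f x) = x by exact: pE.
(* If [y - f (p y)] were nonzero, [fg] would put a nonzero multiple of it in the image of [f], which
   [f \o p] fixes; but [p] kills it. *)
exists p => // y; apply/esym/eqP; rewrite -subr_eq0; apply/eqP.
apply: contrapT => /fg[r [rz fgrz]]; apply: rz; rewrite -fgrz.
by rewrite -(pf (g _)) fgrz pZ pB pf subrr scaler0 f0.
Qed.

End InjectiveModule.

(** * A maximal isomorphism between independent submodules *)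

Section MaximalSwap.
Variables (R : pzRingType) (E : lmodType R^c).

(* [G] is the graph of an isomorphism between two submodules [U], [V] with
   [U `&` V = 0]; injectivity and functionality are the cases [x = 0]. *)
Definition swap_graph (G : set (E * E)) : Prop :=
  submodule G /\ forall x y z, G (x, y) -> G (z, x) -> y = 0 /\ z = 0.

Lemma maximal_swap_graph : exists2 G, swap_graph G &
  forall H, G `<=` H -> swap_graph H -> H `<=` G.
Proof.
have P0 : swap_graph [set 0].
  split; last by move=> x y z [_ ->] [->].
  by split=> // a _ _ -> ->; rewrite /= scaler0 addr0.
have [F F0 PF totF|G [_ PG Gmax]] := Zorn_above P0; last by exists G.
split; first by apply: (submodule_bigcup F0) => // X /PF[[]].
move=> x y z [X FX Xxy] [Y FY Yzx].
have [XY|YX] := totF _ _ FX FY.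
  by have [[_ swY] _] := PF _ FY; apply: swY Yzx; exact: XY.
by have [[_ swX] _] := PF _ FX; apply: swX Xxy _; exact: YX.
Qed.

Hypothesis injE : injective_module E.

Local Notation pi := (\pi_(endoq E))%qT.

(** On the essential submodule [U + V + W], [a] is the maximal isomorphism from [U] to [V] and [b]
    its inverse, both zero on the other summands. Then [1 - (ab + ba)] projects onto [W], and a
    nonzero square-zero element of its corner would enlarge the isomorphism inside [W]. *)
Lemma endoq_swap : exists a b : endoq E,
  [/\ a * a = 0, b * b = 0, a * b * a = a, b * a * b = b &
      forall x, corner (1 - (a * b + b * a)) x -> x * x = 0 -> x = 0].
Proof.
have [G [sG swapG] Gmax] := maximal_swap_graph.
have G0 : G (0, 0) := sG.1.
have GL r u v u' v' : G (u, v) -> G (u', v') -> G (r *: u + u', r *: v + v').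
  by move=> Guv Guv'; exact: (sG.2 r _ _ Guv Guv').
have GN x y : G (x, y) -> G (- x, - y).
  by move=> Gxy; have := submoduleN sG Gxy.
pose U : set E := [set u | exists v, G (u, v)].
pose V : set E := [set v | exists u, G (u, v)].
have sU : submodule U.
  split; first by exists 0.
  by move=> r u u' [v Guv] [v' Guv']; exists (r *: v + v'); exact: GL.
have sV : submodule V.
  split; first by exists 0.
  by move=> r v v' [u Guv] [u' Guv']; exists (r *: u + u'); exact: GL.
have sA := submodule_sum sU sV.
have [W [sW disjW essD]] := essential_complement sA.
have sD := submodule_sum sA sW; move: essD sD; set D := sum_set _ W => essD sD.
have DP z : D z -> exists u v u' v' w,
    [/\ G (u, v), G (u', v'), W w & z = u + v' + w].
  by move=> [_ [w [[u [v' [[v Guv] [u' Guv'] ->]] Ww ->]]]]; exists u, v, u', v', w.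
(* Independence of [U], [V], [W], which makes the graphs defining [a] and [b] single-valued. *)
have split0 u v u' v' w : G (u, v) -> G (u', v') -> W w -> 0 = u + v' + w ->
    v = 0 /\ u' = 0.
  move=> Guv Guv' Ww; have Auv : sum_set U V (u + v').
    by exists u, v'; split=> //; [exists v|exists u'].
  move=> /esym/eqP; rewrite addr_eq0 => /eqP uvw.
  have uv0 : u + v' = 0.
    by apply: disjW => //; rewrite uvw; exact: submoduleN.
  have uE : u = - v' by apply/eqP; rewrite -addr_eq0 uv0.
  have := GN _ _ Guv'; rewrite -uE => /(swapG _ _ _ Guv)[-> /eqP].
  by rewrite oppr_eq0 => /eqP.
have FL r (u v u' v' w s t s' t' x : E) : G (u, v) -> G (u', v') -> W w ->
    G (s, t) -> G (s', t') -> W x ->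
    [/\ G (r *: u + s, r *: v + t), G (r *: u' + s', r *: v' + t'),
        W (r *: w + x) & r *: (u + v' + w) + (s + t' + x)
          = (r *: u + s) + (r *: v' + t') + (r *: w + x)].
  move=> Guv Guv' Ww Gst Gst' Wx; split; [exact: GL|
    exact: GL|by apply sW|].
  by rewrite !scalerDr addrACA (addrACA (r *: u)).
have W0 : W 0 by case: sW.
have [|||a aE] := @linear_extension _ _ injE (fun z y => exists u u' v' w,
    [/\ G (u, y), G (u', v'), W w & z = u + v' + w]).
- by exists 0, 0, 0, 0; rewrite !addr0.
- move=> r _ v _ t [u [u' [v' [w [? ? ? ->]]]]] [s [s' [t' [x [? ? ? ->]]]]].
  by do 4!eexists; apply: FL; eassumption.
- by move=> v [u [u' [v' [w [Guv Guv' Ww /(split0 _ _ _ _ _ Guv Guv' Ww)[]]]]]].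
have [|||b bE] := @linear_extension _ _ injE (fun z y => exists u v v' w,
    [/\ G (u, v), G (y, v'), W w & z = u + v' + w]).
- by exists 0, 0, 0, 0; rewrite !addr0.
- move=> r _ u' _ s' [u [v [v' [w [? ? ? ->]]]]] [s [t [t' [x [? ? ? ->]]]]].
  by do 4!eexists; apply: FL; eassumption.
- by move=> u' [u [v [v' [w [Guv Guv' Ww /(split0 _ _ _ _ _ Guv Guv' Ww)[]]]]]].
have aD u v u' v' w : G (u, v) -> G (u', v') -> W w -> a (u + v' + w) = v.
  by move=> Guv Guv' Ww; apply: aE; exists u, u', v', w.
have bD u v u' v' w : G (u, v) -> G (u', v') -> W w -> b (u + v' + w) = u'.
  by move=> Guv Guv' Ww; apply: bE; exists u, v, v', w.
have aU u v : G (u, v) -> a u = v.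
  by move=> Guv; rewrite -[u]addr0 -[u + 0]addr0; exact: (aD _ _ 0 0).
have aV u v : G (u, v) -> a v = 0.
  by move=> Guv; rewrite -[v]add0r -[0 + v]addr0; exact: (aD 0 0 u v).
have bU u v : G (u, v) -> b u = 0.
  by move=> Guv; rewrite -[u]addr0 -[u + 0]addr0; exact: (bD _ v 0 0).
have bV u v : G (u, v) -> b v = u.
  by move=> Guv; rewrite -[v]add0r -[0 + v]addr0; exact: (bD 0 0 u v).
pose k := endo_add (@endo1 _ E)
  (endo_opp (endo_add (endo_mul a b) (endo_mul b a))).
have kD u v u' v' w : G (u, v) -> G (u', v') -> W w -> k (u + v' + w) = w.
  move=> Guv Guv' Ww; rewrite /= (aD _ _ _ _ _ Guv Guv' Ww).
  by rewrite (bD _ _ _ _ _ Guv Guv' Ww) (aU _ _ Guv') (bV _ _ Guv)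
    [v' + u]addrC addrAC subrr add0r.
have kE : 1 - (pi a * pi b + pi b * pi a) = pi k.
  rewrite !pi_endo_mul (pi_endo_add (endo_mul a b)) pi_endo_opp.
  exact: (pi_endo_add (@endo1 _ E)).
exists (pi a), (pi b); rewrite kE -pi_endo0 !pi_endo_mul; split.
- apply/endoq_eqP; apply: essentialS essD =>
    z /DP[u [v [u' [v' [w [Guv Guv' Ww ->]]]]]] /=.
  by rewrite (aD _ _ _ _ _ Guv Guv' Ww) (aV _ _ Guv).
- apply/endoq_eqP; apply: essentialS essD =>
    z /DP[u [v [u' [v' [w [Guv Guv' Ww ->]]]]]] /=.
  by rewrite (bD _ _ _ _ _ Guv Guv' Ww) (bU _ _ Guv').
- apply/endoq_eqP; apply: essentialS essD =>
    z /DP[u [v [u' [v' [w [Guv Guv' Ww ->]]]]]] /=.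
  by rewrite (aD _ _ _ _ _ Guv Guv' Ww) (bV _ _ Guv) (aU _ _ Guv).
- apply/endoq_eqP; apply: essentialS essD =>
    z /DP[u [v [u' [v' [w [Guv Guv' Ww ->]]]]]] /=.
  by rewrite (bD _ _ _ _ _ Guv Guv' Ww) (aU _ _ Guv') (bV _ _ Guv').
elim/endoqP => f []; rewrite !pi_endo_mul.
move=> /endoq_eqP /= kf /endoq_eqP /= fk /endoq_eqP /= ff.
have [f0 fD fB fZ] := rlin_raddf (endoP f).
have [k0 _ _ kZ] := rlin_raddf (endoP k).
(* An essential submodule on which [k f = f], [f k = f] and [f f = 0] hold exactly, and where
   arguments and values of [f] decompose along [U + V + W]. *)
have essX := essentialI (submodule_eq (endoP (endo_mul k f)) (endoP f)) kf
  (essentialI (submodule_eq (endoP (endo_mul f k)) (endoP f)) fk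
  (essentialI (submodule_eq (endoP (endo_mul f f)) (endoP (@endo0 _ E))) ff
  (essentialI sD essD (essential_preimage (endoP f) sD.1 essD)))).
(* Otherwise [f] is injective on the line of some nonzero [z0]. *)
apply/endoq_eqP => z0 z00; apply: contrapT => nker.
have kerf r : f (r *: z0) = 0 -> r *: z0 = 0.
  by move=> frz; apply: contrapT => rz; apply: nker; exists r.
have [r [rz]] := essX _ z00; set l := r *: z0 in rz *.
move=> [/= kfl [/= fkl [/= ffl [Dl Dfl]]]].
(* The component [w = k l] replaces [l]: [f w = f (k l) = f l], and this lies in [W] since
   [k (f l) = f l]. *)
have [u [v [u' [v' [w [Guv Guv' Ww lE]]]]]] := DP _ Dl.
have kl : k l = w by rewrite lE (kD _ _ _ _ _ Guv Guv' Ww).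
have fw : f w = f l by rewrite -kl.
have Wfw : W (f w).
  have [s [t [s' [t' [x [Gst Gst' Wx flE]]]]]] := DP _ Dfl.
  rewrite fw; have <- : k (f l) = f l by exact: kfl.
  by rewrite flE (kD _ _ _ _ _ Gst Gst' Wx).
have kerw s : f (s *: w) = 0 -> s *: w = 0.
  move=> fsw; rewrite -kl -kZ /l scalerA kerf ?k0 //.
  by rewrite -scalerA -/l fZ -fw -fZ.
have disjUV p q s t : U p -> V q -> p + s *: w = q + t *: f w ->
    p = q /\ s *: w = t *: f w.
  move=> Up Vq eqpq; have pqE : p - q = t *: f w - s *: w.
    by apply/eqP; rewrite subr_eq addrAC eq_sym subr_eq eqpq addrC.
  have /eqP : p - q = 0.
    apply: disjW; first by exists p, (- q); split=> //; exact: submoduleN.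
    by rewrite pqE; apply: submoduleB => //; exact: submoduleZ.
  rewrite pqE !subr_eq0 => /eqP twE; split; last by rewrite twE.
  by apply/eqP; rewrite -subr_eq0 pqE twE subrr.
have cancel_line s t : s *: w = t *: f w -> s *: w = 0.
  by move=> swE; apply: kerw; rewrite swE !fZ fw ffl scaler0.
(* [G] enlarged by sending [w] to [f w]. It remains a swap graph because [f] is injective on the
   line of [w] and kills [f w]. *)
pose H : set (E * E) :=
  [set p | exists q s, G q /\ p = q + (s *: w, s *: f w)].
have GH : G `<=` H by move=> q Gq; exists q, 0; rewrite !scale0r addr0.
have swapH : swap_graph H.
  split.
    split; first exact: GH.
    move=> c _ _ [p [s [Gp ->]]] [q [t [Gq ->]]]; exists (c *: p + q), (c * s + t).
    split; first by apply sG.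
    by rewrite scalerDr addrACA !scalerDl -!scalerA.
  move=> x y z [[p q] [s [Gpq [xE yE]]]] [[p' q'] [t [Gpq' [zE xE']]]].
  have [|||pq' swE] := disjUV p q' s t; first by exists q.
  - by exists p'.
  - by rewrite -xE xE'.
  have sw0 := cancel_line _ _ swE.
  rewrite -pq' in Gpq'; have [q0 p'0] := swapG _ _ _ Gpq Gpq'.
  rewrite yE zE q0 p'0 -fZ sw0 f0 !add0r; split=> //.
  by apply: kerw; rewrite fZ -swE.
have Gw : G (w, f w).
  apply: (Gmax H GH swapH); exists (0, 0), 1; split=> //.
  by rewrite !scale1r; congr pair; rewrite add0r.
have w0 : w = 0.
  by apply: disjW => //; exists w, 0; rewrite addr0; split=> //;
    [exists (f w)|exists 0].
by apply: rz; apply: kerf; rewrite -/l -fw w0 f0.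
Qed.

End MaximalSwap.

(** * Injective hulls *)

Section InjectiveHull.
Variables (R : pzRingType) (M E : lmodType R^c) (j : M -> E).
Hypothesis hull : injective_hull j.

Local Notation pi := (\pi_(endoq E))%qT.

Let injE : injective_module E. Proof. by case: hull. Qed.
Let jl : rlin j. Proof. by case: hull => _ []. Qed.
Let jI : injective j. Proof. by case: hull => _ [_ []]. Qed.

Lemma hull_essential : essential (range j).
Proof.
case: hull => _ [_ [_ ess]] x x0.
have [|m [[r _ rx] jm0]] := ess _ (submodule_line x).
  by exists x; split=> //; exists 1; rewrite ?scale1r.
by exists r; rewrite rx; split=> //; exists m.
Qed.

Lemma hull_extension (L : set M) (f : M -> E) : submodule L ->
    (forall (a : R^c) u v, L u -> L v -> f (a *: u + v) = a *: f u + f v) ->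
  exists g : endo E, forall x, L x -> g (j x) = f x.
Proof.
move=> [L0 LL] fL; have [j0 _ _ _] := rlin_raddf jl.
have f0 : f 0 = 0.
  have := fL 1 0 0 L0 L0; rewrite !scale1r addr0 => f00.
  by apply: (@addrI _ (f 0)); rewrite addr0 -f00.
have [|||g gE] := @linear_extension _ _ injE
    (fun x y => exists m, [/\ L m, x = j m & y = f m]).
- by exists 0; rewrite j0 f0.
- move=> r _ _ _ _ [m [Lm -> ->]] [m' [Lm' -> ->]]; exists (r *: m + m').
  by rewrite jl fL //; split=> //; exact: LL.
- by move=> _ [m [_ jm ->]]; rewrite (_ : m = 0) //; apply: jI; rewrite j0 -jm.
by exists g => x Lx; apply: gE; exists x.
Qed.

Definition stable (f : E -> E) : Prop := forall m, exists m', f (j m) = j m'.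

(** A partial map of [M] extends to [E] by injectivity, and stability brings the extension back to
    [M]. *)
Lemma stable_quasi_injective :
  (forall f : endo E, stable f) -> quasi_injective M.
Proof.
move=> st L f sL fL.
have [|g gE] := @hull_extension L (j \o f) sL.
  by move=> a u v Lu Lv /=; rewrite fL // jl.
have [h hE] := choice (st g).
exists h; split=> [a u v|x Lx]; apply: jI; last by rewrite -hE gE.
by rewrite jl -!hE jl endoP.
Qed.

(** On the part [L] of [M] that [sigma] sends into [M], [sigma] extends to an endomorphism [g] of
    [M]. If [sigma] and [g] differed at [m], some nonzero multiple by [r] of the difference would
    lie in [M]; then [r *: m] is in [L], where they agree. *)
Lemma quasi_injective_aut_invariant : quasi_injective M -> aut_invariant j.
Proof.
move=> qi sigma sl _ m; pose L : set M := [set x | exists y, sigma (j x) = j y].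
have [s0 _ sB sZ] := rlin_raddf sl; have [j0 _ jB jZ] := rlin_raddf jl.
have sL : submodule L.
  split; first by exists 0; rewrite j0 s0.
  move=> a u v [u' uE] [v' vE]; exists (a *: u' + v').
  by rewrite jl sl uE vE jl.
(* Outside [L] the value [0] is an arbitrary default. *)
have [|f fE] := @choice _ _ (fun x y => L x -> sigma (j x) = j y).
  by move=> x; have [[y yE]|nLx] := pselect (L x); [exists y|exists 0].
have [|g [gl gE]] := qi L f sL.
  move=> a u v Lu Lv; apply: jI; rewrite jl -!fE //; last by apply sL.
  by rewrite jl sl.
have [_ _ _ gZ] := rlin_raddf gl.
exists (g m); apply/eqP; rewrite -subr_eq0; apply/eqP.
apply: contrapT => /hull_essential[r [rd [y _ yE]]]; apply: rd.
rewrite scalerBr -sZ -!jZ -gZ in yE *.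
have Lrm : L (r *: m).
  exists (y + g (r *: m)).
  by have [_ -> _ _] := rlin_raddf jl; rewrite yE subrK.
by rewrite fE // gE // subrr.
Qed.

Hypothesis autj : aut_invariant j.

Let T (q : endoq E) : Prop := exists2 f : endo E, pi f = q & stable f.

Let TB p q : T p -> T q -> T (p - q).
Proof.
move=> [f <- fs] [g <- gs]; exists (endo_add f (endo_opp g)).
  by rewrite pi_endo_opp pi_endo_add.
move=> m; have [m1 m1E] := fs m; have [m2 m2E] := gs m; exists (m1 - m2).
by have [_ _ -> _] := rlin_raddf jl; rewrite /= m1E m2E.
Qed.

Let TM p q : T p -> T q -> T (p * q).
Proof.
move=> [f <- fs] [g <- gs]; exists (endo_mul f g); first by rewrite pi_endo_mul.
by move=> m; have [m1 m1E] := gs m; have [m2 m2E] := fs m1; exists m2;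
  rewrite /= m1E.
Qed.

Let stable_unit f g : pi f * pi g = 1 -> pi g * pi f = 1 -> stable f.
Proof.
by move=> fg gf m; apply: autj; [exact: endoP|exact: endoq_unit_bijective gf].
Qed.

Let Tunit p q : p * q = 1 -> q * p = 1 -> T p.
Proof.
elim/endoqP: p => f; elim/endoqP: q => g fg gf.
by exists f => //; exact: stable_unit fg gf.
Qed.

(** Stability depends only on the class: if [g] is stable in the class of [f], then [h = f - g + 1]
    has class [1], hence is stable, and [f = g + h - 1]. *)
Let T_stable f : T (pi f) -> stable f.
Proof.
move=> [g gf gs] m; have [m1 m1E] := gs m.
pose h := endo_add (endo_add f (endo_opp g)) (@endo1 _ E).
have h1 : pi h = 1.
  by rewrite -pi_endo_add -pi_endo_add -pi_endo_opp gf subrr add0r.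
have [||m2 m2E] := @stable_unit h (@endo1 _ E) _ _ m.
- by rewrite h1 mul1r.
- by rewrite h1 mulr1.
exists (m1 + m2 - m); have [_ jD jB _] := rlin_raddf jl.
by rewrite jB jD -m1E -m2E /= addrCA addrA addrK subrK.
Qed.

Lemma aut_invariant_stable :
  ~ End_has_F2_factor M -> forall f : endo E, stable f.
Proof.
move=> nF2 f; apply: T_stable; apply: contrapT => nTf; apply: nF2.
have [a [b [aa bb aba bab reduced]]] := endoq_swap injE.
have [||x|phi [phi1 phiD phiM]] := @boolean_F2_morphism _ (unitgen_ideal T).
- split=> [|x y|u x|u x].
  + exact: unitgen_ideal0.
  + exact: unitgen_idealB.
  + exact: unitgen_idealMl.
  + exact: unitgen_idealMr.
(* If the ideal contained [1], it would contain [pi f], contrary to [nTf]. *)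
- by move/(_ 1 (pi f)); rewrite !mul1r.
- by apply: (unitgen_ideal_boolean TB TM Tunit (endoq_regular injE) aa bb
    aba bab reduced).
(* Maps that are not linear receive the zero endomorphism as a default. *)
have [|ext extE] := @choice _ (endo E)
    (fun g h => rlin g -> forall m, h (j m) = j (g m)).
  move=> g; have [gl|ngl] := pselect (rlin g); last by exists (@endo0 _ E).
  have [||h hE] := @hull_extension setT (j \o g) => //.
    by move=> c u v _ _ /=; rewrite gl jl.
  by exists h => _ m; exact: hE.
(* The class of an extension is determined on [M], since [M] is essential in [E]; this makes [ext]
   compatible with sums and composites modulo essential kernels. *)
have piE (g h : endo E) : (forall m, g (j m) = h (j m)) -> pi g = pi h.
  move=> gh; apply/endoq_eqP; apply: essentialS hull_essential.
  by move=> _ [m _ <-]; exact: gh.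
exists (fun g => phi (pi (ext g))); split=> [|g h gl hl].
  by rewrite -[RHS]phi1 -pi_endo1; congr phi; apply: piE => m; rewrite extE.
split; [rewrite -phiD pi_endo_add|rewrite -phiM pi_endo_mul]; congr phi;
  apply: piE => m /=.
  rewrite !extE //; first by have [_ -> _ _] := rlin_raddf jl.
  by move=> c u v; rewrite gl hl scalerDr addrACA.
by rewrite !extE // => c u v /=; rewrite hl gl.
Qed.

End InjectiveHull.

Theorem theorem3 (R : pzRingType) (M : lmodType R^c)
    (E : lmodType R^c) (j : M -> E) :
  injective_hull j ->
  ~ End_has_F2_factor M ->
  (quasi_injective M <-> aut_invariant j).
Proof.
move=> hull nF2; split; first exact: quasi_injective_aut_invariant.
by move=> autj; apply: (stable_quasi_injective hull); exact: aut_invariant_stable.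
Qed.
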